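(* For every $\lambda\in\mathcal P_\epsilon(N)$, $$z(\lambda)=\max|\mathbf i|,$$ the maximum taken over all admissible sequences $\mathbf i$ for $\lambda$ (here $|\mathbf i|$ is the length of $\mathbf i$).
   Context: $\mathcal P_\epsilon(N)$ ($\epsilon=\pm1$) is the set of partitions $\lambda=(\lambda_1\ge\dots\ge\lambda_n\ge1)$ of $N$ in which every part $m$ with $\epsilon(-1)^m=1$ occurs with even multiplicity; conventions $\lambda_0=0$, $\lambda_i=0$ for $i>n$. $s(\lambda)=\sum_{i=1}^n\lfloor(\lambda_i-\lambda_{i+1})/2\rfloor$. A 2-step of $\lambda$ is a pair $(i,i+1)$, $1\le i<n$, with $\epsilon(-1)^{\lambda_i}=\epsilon(-1)^{\lambda_{i+1}}=-1$, $\lambda_{i-1}\ne\lambda_i$, $\lambda_{i+1}\ne\lambda_{i+2}$; $\Delta(\lambda)$ is the set of 2-steps. A 2-step $(i,i+1)$ is bad if ($i>1$ and $\lambda_{i-1}-\lambda_i$ is even) or $\lambda_{i+1}-\lambda_{i+2}$ is even, good otherwise; $\Delta_{\rm bad}(\lambda)$ is the set of bad 2-steps. A 2-cluster is a sequence $i_1<\dots<i_k$ with $k\ge2$, $(i_j,i_j+1)\in\Delta(\lambda)$ for all $j$ and $i_{j+1}=i_j+2$; it has a bad boundary if ($i_1>1$ and $\lambda_{i_1-1}-\lambda_{i_1}$ is a positive even integer) or $\lambda_{i_k+1}-\lambda_{i_k+2}$ is a positive even integer; a good 2-cluster is one without bad boundary, and $\Sigma(\lambda)$ is the set of good 2-clusters.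 Define $z(\lambda)=s(\lambda)+|\Delta(\lambda)|-|\Delta_{\rm bad}(\lambda)|+|\Sigma(\lambda)|$. KS algorithm: for $1\le i\le n$, Case 1 occurs at $i$ if $\lambda_i\ge\lambda_{i+1}+2$, and then $\lambda^{(i)}=(\lambda_1-2,\dots,\lambda_i-2,\lambda_{i+1},\dots,\lambda_n)$; Case 2 occurs at $i$ if $(i,i+1)\in\Delta(\lambda)$ and $\lambda_i=\lambda_{i+1}$, and then $\lambda^{(i)}=(\lambda_1-2,\dots,\lambda_{i-1}-2,\lambda_i-1,\lambda_{i+1}-1,\lambda_{i+2},\dots,\lambda_n)$; zero parts discarded, $\lambda^{(i)}\in\mathcal P_\epsilon(N-2i)$. A sequence $(i_1,\dots,i_l)$ is admissible for $\lambda$ if for each $k$ Case 1 or Case 2 occurs at $i_k$ for $\lambda^{(i_1,\dots,i_{k-1})}$, where $\lambda^\emptyset=\lambda$ and $\lambda^{(i_1,\dots,i_k)}=(\lambda^{(i_1,\dots,i_{k-1})})^{(i_k)}$. *)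

(* Defs.v *)
From mathcomp Require Import all_boot all_order all_algebra.
Set Implicit Arguments. Unset Strict Implicit. Unset Printing Implicit Defensive.
Import GRing.Theory.

Definition sgnE (eps : int) (m : nat) : int := (eps * (-1) ^+ m)%R.

(* lambda_i with 1-based indexing, lambda_0 = 0, lambda_i = 0 for i > n *)
Definition part (lam : seq nat) (i : nat) : nat :=
  if i is i'.+1 then nth 0 lam i' else 0.

Definition inP (eps : int) (N : nat) (lam : seq nat) : bool :=
  [&& sorted geq lam, all (fun x => 0 < x) lam, sumn lam == N &
      all (fun m => (sgnE eps m == 1%R) ==> ~~ odd (count_mem m lam)) lam].

Definition sfun (lam : seq nat) : nat :=
  \sum_(1 <= i < (size lam).+1) ((part lam i - part lam i.+1)./2).

Definition twoStep (eps : int) (lam : seq nat) (i : nat) : bool :=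
  [&& 1 <= i, i < size lam,
      sgnE eps (part lam i) == (-1)%R, sgnE eps (part lam i.+1) == (-1)%R,
      part lam i.-1 != part lam i & part lam i.+1 != part lam i.+2].

Definition badStep (eps : int) (lam : seq nat) (i : nat) : bool :=
  twoStep eps lam i &&
  (((1 < i) && ~~ odd (part lam i.-1 - part lam i))
   || ~~ odd (part lam i.+1 - part lam i.+2)).

Definition posEven (d : nat) : bool := (0 < d) && ~~ odd d.

(* the sequence i1, i1+2, ..., i1+2(k-1) is a 2-cluster *)
Definition isCluster (eps : int) (lam : seq nat) (i1 k : nat) : bool :=
  (2 <= k) && all (fun j => twoStep eps lam (i1 + j.*2)) (iota 0 k).

(* ... and it is a good 2-cluster (no bad boundary); i_k = i1 + 2(k-1) *)
Definition goodCluster (eps : int) (lam : seq nat) (i1 k : nat) : bool :=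
  isCluster eps lam i1 k &&
  ~~ (((1 < i1) && posEven (part lam i1.-1 - part lam i1))
      || posEven (part lam (i1 + (k.-1).*2).+1 - part lam (i1 + (k.-1).*2).+2)).

(* |Sigma(lambda)|: every 2-cluster has 1 <= i1 < n and 2 <= k <= n *)
Definition nGoodClusters (eps : int) (lam : seq nat) : nat :=
  \sum_(1 <= i1 < size lam) \sum_(2 <= k < (size lam).+1) goodCluster eps lam i1 k.

(* z(lambda) = s + |Delta| - |Delta_bad| + |Sigma|  (Delta_bad is a subset of Delta) *)
Definition zfun (eps : int) (lam : seq nat) : nat :=
  sfun lam + count (twoStep eps lam) (iota 1 (size lam))
  - count (badStep eps lam) (iota 1 (size lam)) + nGoodClusters eps lam.

Definition case1 (lam : seq nat) (i : nat) : bool :=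
  (1 <= i <= size lam) && (part lam i.+1 + 2 <= part lam i).

Definition case2 (eps : int) (lam : seq nat) (i : nat) : bool :=
  twoStep eps lam i && (part lam i == part lam i.+1).

Definition ksStep (lam : seq nat) (i : nat) : seq nat :=
  if case1 lam i then
    filter (fun x => x != 0) ([seq x - 2 | x <- take i lam] ++ drop i lam)
  else
    filter (fun x => x != 0)
      ([seq x - 2 | x <- take i.-1 lam] ++ [seq x.-1 | x <- take 2 (drop i.-1 lam)]
       ++ drop i.+1 lam).

Fixpoint admissible (eps : int) (lam : seq nat) (s : seq nat) : bool :=
  match s with
  | [::] => true
  | i :: s' => (case1 lam i || case2 eps lam i) && admissible eps (ksStep lam i) s'
  end.

(* Main.v *)
Require Import Defs.
From mathcomp Require Import all_boot all_order all_algebra.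
From mathcomp Require Import zify.

Set Implicit Arguments.
Unset Strict Implicit.
Unset Printing Implicit Defensive.

(** In terms of the gaps [d_i = lambda_i - lambda_(i+1)], Case 1 at [i] lowers
    [d_i] by 2, and Case 2 at [i] (where [d_i = 0]) lowers [d_(i-1)] and
    [d_(i+1)] by 1. A good 2-step is a chain of length one with the same
    boundary condition as a good 2-cluster, so [z] is the sum of the floors of
    [d_i / 2] plus the number of good chains of 2-steps of any length. A
    four-state automaton reading the gaps from left to right computes this
    number. On the automaton, local inspection shows that every step lowers
    [z] by at least 1. As long as [z > 0], some step lowers it by exactly 1:
    Case 1 at a gap that no chain needs to be positive, or Case 2 at the first
    pair of a maximal run of parts of the parity allowed in 2-steps. *)

(** * The automaton on sequences of gaps *)

(** The state before reading [d_i] describes [lambda_i]: [Off] when [eps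
    (-1)^lambda_i = 1]; otherwise [First] or [Second] according to its place
    in a 2-step of a chain that may still become good, and [Dead] when no such
    chain is left. *)
Inductive state := Off | First | Second | Dead.

Definition is_off (q : state) : bool := if q is Off then true else false.

Definition is_second (q : state) : bool := if q is Second then true else false.

Definition next (q : state) (d : nat) : state :=
  match q with
  | Off => if odd d then First else Off
  | First => if odd d then Off else Second
  | Second => if odd d then Off else if d is 0 then Dead else First
  | Dead => if odd d then Off else Dead
  end.

(** The bonus counts a chain at the moment when an odd gap closes it on the right, which makes it
    good. *)
Fixpoint zrun (q : state) (l : seq nat) : nat :=
  if l is d :: l' then d./2 + (is_second q && odd d) + zrun (next q d) l' else 0.

Lemma zrun_cat q l1 l2 :
  zrun q (l1 ++ l2) = zrun q l1 + zrun (foldl next q l1) l2.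
Proof. by elim: l1 q => [|d l1 IH] q //=; rewrite IH !addnA. Qed.

Lemma zrun_nseq0 q k : zrun q (nseq k 0) = 0.
Proof. by elim: k q => [|k IH] q //=; rewrite IH andbF. Qed.

(** From [First], [Second] and [Dead] the automaton returns to [Off] at the same gap, the first odd
    one. The values differ at most by the bonus earned there, which [Dead] never earns. *)
Lemma zrun_dead_le l :
  zrun Dead l <= zrun First l /\ zrun Dead l <= zrun Second l.
Proof.
elim: l => [|d l [IH1 IH2]] //=; case: (odd d) => /=; first by lia.
by case: d => [|d] /=; lia.
Qed.

Lemma zrun_le_dead l :
  zrun First l <= (zrun Dead l).+1 /\ zrun Second l <= (zrun Dead l).+1.
Proof.
elim: l => [|d l [IH1 IH2]] //=; case: (odd d) => /=; first by lia.
by case: d => [|d] /=; lia.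
Qed.

(** Parity is kept, so the next state changes only from [Second] with [d = 0], where [First] becomes
    [Dead]; this cannot raise the value of the rest. *)
Lemma zrun_sub2 q d l :
  zrun q (d :: l) < zrun q (d.+2 :: l).
Proof.
have [h1 h2] := zrun_dead_le l.
case: q => //=; rewrite negbK; case: (odd d) => /=; try lia.
by case: d => [|d]; lia.
Qed.

Lemma zrun_sub2_eq q d l :
  ~~ is_second q -> zrun q (d.+2 :: l) = (zrun q (d :: l)).+1.
Proof. by case: q => //= _; rewrite negbK; case: (odd d) => /=; lia. Qed.

(** Models Case 2 at [i > 1]; the hypothesis says that [lambda_i] has the parity allowed in 2-steps.
    Afterwards both readings are in [Off] or neither is, so the bounds relative to [Dead] apply. *)
Lemma zrun_sub1 q a b l : ~~ is_off (next q a.+1) ->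
  zrun q [:: a, 0, b & l] < zrun q [:: a.+1, 0, b.+1 & l].
Proof.
have [h1 h2] := zrun_dead_le l; have [h3 h4] := zrun_le_dead l.
have := odd_double_half a; have := odd_double_half b.
have := uphalf_half a; have := uphalf_half b.
by case Ea: (odd a); case Eb: (odd b); case: q => /=; rewrite ?Ea ?Eb /= ?Eb /=; lia.
Qed.

(** For even [b] only the bonus of the chain closed by [b.+1] is lost; for odd [b] only the half of
    [b.+1] drops. The states afterwards agree. *)
Lemma zrun_sub1_off a b l : ~~ odd a ->
  zrun Off [:: a.+1, 0, b.+1 & l] = (zrun Off [:: a, 0, b & l]).+1.
Proof.
move=> /negbTE Ea; case Eb: (odd b).
  by rewrite /= !uphalf_half Ea /= Eb /=; lia.
by rewrite /= !uphalf_half Ea /= Eb /=; lia.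
Qed.

(** Models Case 2 at 1: the first part changes parity, so the start state turns from [First] into
    [Off]. *)
Lemma zrun_sub1_head b l :
  zrun First [:: 0, b.+1 & l] = (zrun Off [:: 0, b & l]).+1.
Proof. by rewrite /= uphalf_half; case: (odd b) => /=; lia. Qed.

(** The first two outcomes are usable moves. The other two describe a tail whose pair began earlier:
    prefixing a gap 0 read in [First] turns the fourth into the third, and a gap 1 read in [Off]
    turns the third into the second. *)
Lemma zrun_exact_step q l : 0 < zrun q l ->
  [\/ exists l1 d l2, l = l1 ++ d.+2 :: l2 /\ ~~ is_second (foldl next q l1),
      exists l1 a b l2, [/\ l = l1 ++ [:: a.+1, 0, b.+1 & l2],
        foldl next q l1 = Off & ~~ odd a],
      q = First /\ exists b l2, l = [:: 0, b.+1 & l2] |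
      q = Second /\ exists b l2, l = b.+1 :: l2].
Proof.
have lift q' d l' :
  (exists l1 x l2, l' = l1 ++ x.+2 :: l2 /\
    ~~ is_second (foldl next (next q' d) l1)) ->
  exists l1 x l2, d :: l' = l1 ++ x.+2 :: l2 /\
    ~~ is_second (foldl next q' l1).
  by move=> [l1 [x [l2 [-> h]]]]; exists (d :: l1), x, l2.
have lift2 q' d l' :
  (exists l1 a b l2, [/\ l' = l1 ++ [:: a.+1, 0, b.+1 & l2],
        foldl next (next q' d) l1 = Off & ~~ odd a]) ->
  exists l1 a b l2, [/\ d :: l' = l1 ++ [:: a.+1, 0, b.+1 & l2],
        foldl next q' l1 = Off & ~~ odd a].
  by move=> [l1 [a [b [l2 [-> h1 h2]]]]]; exists (d :: l1), a, b, l2.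
elim: l q => [|d l IH] q // h.
(* A gap of at least 2 settles every state but [Second], where any positive gap does; other gaps add
   nothing, so positivity passes to the tail. *)
case: q h => [|||] h.
- case: d h => [|[|d]] h; last by apply: Or41; exists [::], d, l.
  + case: (IH Off h) => [h'|h'|[]|[]] //; first exact/Or41/lift.
    exact/Or42/lift2.
  + case: (IH First h) => [h'|h'|[_ [b [l2 ->]]]|[]] //; first exact/Or41/lift.
      exact/Or42/lift2.
    by apply: Or42; exists [::], 0, b, l2.
- case: d h => [|[|d]] h; last by apply: Or41; exists [::], d, l.
  + case: (IH Second h) => [h'|h'|[]|[_ [b [l2 ->]]]] //; first exact/Or41/lift.
      exact/Or42/lift2.
    by apply: Or43; split=> //; exists b, l2.
  + case: (IH Off h) => [h'|h'|[]|[]] //; first exact/Or41/lift.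
    exact/Or42/lift2.
- case: d h => [|d] h; last by apply: Or44; split=> //; exists d, l.
  case: (IH Dead h) => [h'|h'|[]|[]] //; first exact/Or41/lift.
  exact/Or42/lift2.
- case: d h => [|[|d]] h; last by apply: Or41; exists [::], d, l.
  + case: (IH Dead h) => [h'|h'|[]|[]] //; first exact/Or41/lift.
    exact/Or42/lift2.
  + case: (IH Off h) => [h'|h'|[]|[]] //; first exact/Or41/lift.
    exact/Or42/lift2.
Qed.

(** * Parts, gaps and types *)

(** The default 0 extends this past the end and to sequences whose zero parts are not yet
    dropped. *)
Definition nonincreasing_parts (lam : seq nat) : Prop :=
  forall i, nth 0 lam i.+1 <= nth 0 lam i.

Lemma sorted_nonincreasing_parts lam :
  sorted geq lam -> nonincreasing_parts lam.
Proof.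
move=> h i; case: (ltnP i.+1 (size lam)) => hi; last by rewrite nth_default.
elim: lam i h hi => [|x [|y lam] IH] [|i] //=; first by case/andP.
by case/andP=> _ h hi; apply: IH.
Qed.

Definition gap (lam : seq nat) (i : nat) : nat := part lam i - part lam i.+1.

Definition gaps (lam : seq nat) (m n : nat) : seq nat :=
  [seq gap lam i | i <- iota m n].

Definition etype (eps : int) (lam : seq nat) (i : nat) : bool :=
  sgnE eps (part lam i) == (-1)%R.

Definition start (eps : int) (lam : seq nat) : state :=
  if etype eps lam 1 then First else Off.

Lemma size_gaps lam m n : size (gaps lam m n) = n.
Proof. by rewrite size_map size_iota. Qed.

Lemma nth_gaps lam m n j : j < n -> nth 0 (gaps lam m n) j = gap lam (m + j).
Proof. by move=> h; rewrite (nth_map 0) ?size_iota // nth_iota. Qed.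

Lemma gap_default lam i : size lam < i -> gap lam i = 0.
Proof.
by case: i => // i h; rewrite /gap /part !nth_default //; lia.
Qed.

Section Types.

Variable eps : int.
Hypothesis heps : eps = 1%R \/ eps = (-1)%R.

Lemma etypeE lam i :
  etype eps lam i = odd (part lam i) (+) (eps == (-1)%R).
Proof.
rewrite /etype /sgnE -GRing.signr_odd.
by case: heps => ->; case: (odd _).
Qed.

(** Types compare like parities, so the automaton, which sees only parities of gaps, can track
    types. *)
Lemma odd_gap lam i : nonincreasing_parts lam -> 0 < i ->
  odd (gap lam i) = etype eps lam i (+) etype eps lam i.+1.
Proof.
case: i => // i h _; rewrite !etypeE /gap oddB; last exact: h.
by case: (odd _); case: (odd _); case: (_ == _).
Qed.

Lemma is_off_next q d : is_off (next q d) = is_off q (+) odd d.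
Proof. by case: q => //=; case: (odd d) => //=; case: d. Qed.

Lemma is_off_foldl lam q m n : nonincreasing_parts lam -> 0 < m ->
  is_off q = ~~ etype eps lam m ->
  is_off (foldl next q (gaps lam m n)) = ~~ etype eps lam (m + n).
Proof.
move=> hl; elim: n m q => [|n IH] m q hm hq /=; first by rewrite addn0.
rewrite -/(gaps lam m.+1 n) IH ?addSnnS // is_off_next hq odd_gap //.
by case: etype; case: etype.
Qed.

Lemma is_off_start lam : is_off (start eps lam) = ~~ etype eps lam 1.
Proof. by rewrite /start; case: etype. Qed.

End Types.

(** * Good chains as patterns of gaps *)

(** Decides whether a good chain can start here once its left boundary is acceptable: gaps inside
    pairs are even, those between pairs positive and even, and an odd gap closes the chain. *)
Fixpoint alive (l : seq nat) : bool :=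
  if l is d :: l1 then
    if l1 is e :: l2 then ~~ odd d && (odd e || ((0 < e) && alive l2)) else false
  else false.

Definition alive_second (l : seq nat) : bool :=
  if l is e :: l2 then odd e || ((0 < e) && alive l2) else false.

Lemma alive_cons d l : alive (d :: l) = ~~ odd d && alive_second l.
Proof. by case: l => //=; rewrite andbF. Qed.

Fixpoint chain_body (l : seq nat) (k : nat) : bool :=
  if l is d :: l1 then
    if l1 is e :: l2 then
      ~~ odd d &&
      (if k is k'.+1 then [&& 0 < e, ~~ odd e & chain_body l2 k'] else odd e)
    else false
  else false.

(** The parity of [e] decides whether a chain stops or continues, so at most one length fits. *)
Lemma sum_chain_body l K : size l <= K ->
  \sum_(0 <= k < K) chain_body l k = alive l.
Proof.
elim: K l => [|K IH] l; first by case: l => // _; rewrite big_geq.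
case: l => [|d [|e l]] /= hl; try by rewrite big1_seq // => -[].
rewrite big_nat_recl //=.
case ho: (odd d) => /=; first by rewrite big1_seq.
case he: (odd e) => /=.
  by rewrite big1_seq // => k _; rewrite andbF.
by case: (0 < e) => /=; [rewrite IH //; lia | rewrite big1_seq].
Qed.

(** The last two terms collect the bonuses: the one pending for the run of allowed parts in which
    reading starts, and one for each later run whose chain closes. *)
Lemma zrun_gapsE (eps : int) lam q m n :
  (eps = 1%R \/ eps = (-1)%R) -> nonincreasing_parts lam -> 0 < m ->
  is_off q = ~~ etype eps lam m ->
  zrun q (gaps lam m n) =
    \sum_(0 <= j < n) (gap lam (m + j))./2 +
    match q with
    | First => alive (gaps lam m n)
    | Second => alive_second (gaps lam m n)
    | _ => false
    end +
    \sum_(0 <= j < n) [&& ~~ etype eps lam (m + j), etype eps lam (m + j).+1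
                        & alive (gaps lam (m + j).+1 (n - j).-1)].
Proof.
move=> heps hl; elim: n m q => [|n IH] m q hm hq.
  by rewrite !big_geq //; case: q {hq}.
rewrite !big_nat_recl //= -/(gaps lam m.+1 n) !addn0.
have ho := odd_gap heps hl hm.
have hq' : is_off (next q (gap lam m)) = ~~ etype eps lam m.+1.
  by rewrite is_off_next hq ho; case: etype; case: etype.
rewrite (IH m.+1 (next q (gap lam m)) isT hq').
have -> : \sum_(0 <= j < n) (gap lam (m.+1 + j))./2 =
          \sum_(0 <= j < n) (gap lam (m + j.+1))./2.
  by apply: eq_bigr => j _; rewrite addSnnS.
have -> : \sum_(0 <= j < n) [&& ~~ etype eps lam (m.+1 + j),
              etype eps lam (m.+1 + j).+1
            & alive (gaps lam (m.+1 + j).+1 (n - j).-1)] =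
          \sum_(0 <= j < n) [&& ~~ etype eps lam (m + j.+1),
              etype eps lam (m + j.+1).+1
            & alive (gaps lam (m + j.+1).+1 (n.+1 - j.+1).-1)].
  by apply: eq_bigr => j _; rewrite addSnnS subSS.
set S1 := \sum_(0 <= j < n) _; set S2 := \sum_(0 <= j < n) _.
rewrite -/(alive (gap lam m :: gaps lam m.+1 n)) alive_cons.
have ht : etype eps lam m = ~~ is_off q by rewrite hq negbK.
have -> : etype eps lam m.+1 = odd (gap lam m) (+) ~~ is_off q.
  by rewrite ho ht; case: is_off; case: etype.
rewrite ht {IH hm hq ho hq' ht}; move: (gaps _ _ _) => l.
move: (gap lam m) => d.
case: q => /=; case Ed: (odd d) => /=; try lia.
by case: d Ed => /=; lia.
Qed.

(** The chain has [k + 1] 2-steps: for [k = 0] this is a good 2-step, for [k >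
    0] a good 2-cluster. *)
Definition good_chain eps lam i k : bool :=
  all (fun j => twoStep eps lam (i + j.*2)) (iota 0 k.+1) &&
  ~~ (((1 < i) && posEven (part lam i.-1 - part lam i))
      || posEven (part lam (i + k.*2).+1 - part lam (i + k.*2).+2)).

(** Gaps past the end vanish, so the positive gap already forces [i < size lam]. *)
Lemma twoStepE eps lam i : nonincreasing_parts lam -> 0 < i ->
  twoStep eps lam i =
  [&& etype eps lam i, etype eps lam i.+1, part lam i.-1 != part lam i
    & 0 < gap lam i.+1].
Proof.
move=> hl hi; rewrite /twoStep hi /= -!/(etype _ _ _).
have hgap : (part lam i.+1 != part lam i.+2) = (0 < gap lam i.+1).
  by have := hl i; rewrite /gap /part; lia.
rewrite hgap; case: ltnP => //= h.
by rewrite gap_default ?ltnS // !andbF.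
Qed.

Lemma chain_bodyE (eps : int) lam i n k :
  (eps = 1%R \/ eps = (-1)%R) -> nonincreasing_parts lam ->
  size lam <= n -> 0 < i <= n -> etype eps lam i ->
  part lam i.-1 != part lam i ->
  all (fun j => twoStep eps lam (i + j.*2)) (iota 0 k.+1)
    && odd (gap lam (i + k.*2).+1)
  = chain_body (gaps lam i (n.+1 - i)) k.
Proof.
move=> heps hl hn; elim: k i => [|k IH] i /andP[hi hin] ht hne.
  rewrite /= addn0 andbT twoStepE // ht hne /=.
  have ho := odd_gap heps hl hi.
  have -> : n.+1 - i = (n - i).+1 by lia.
  rewrite /= ho ht; case E: (n - i) => [|m] /=.
    by rewrite gap_default ?andbF //; lia.
  by case: etype => //=; case: (gap lam i.+1).
(* Peel off the first 2-step; the others form a chain starting at [i.+2]. *)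
have -> : iota 0 k.+2 = 0 :: map S (iota 0 k.+1)
  by rewrite -[X in map X _]/(addn 1) -iotaDl.
rewrite [all _ (0 :: _)]/= all_map.
under eq_all => j do rewrite /= doubleS !addnS -!addSn.
rewrite doubleS !addnS -!addSn addn0.
rewrite twoStepE // ht hne /=.
have ho := odd_gap heps hl hi.
have ho1 := @odd_gap eps heps lam i.+1 hl isT.
have -> : n.+1 - i = (n - i).+1 by lia.
rewrite /= ho ht; case E: (n - i) => [|m] /=.
  by rewrite gap_default ?andbF //; lia.
case ht1: (etype eps lam i.+1) => //=; rewrite ht1 /= in ho1.
case hp: (0 < gap lam i.+1) => //=.
rewrite -/(iota 0 k.+1) -/(all _ (0 :: iota 1 k)).
have -> : m = n.+1 - i.+2 by lia.
have hne2 : part lam i.+1 != part lam i.+2.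
  by move: hp; rewrite /gap; lia.
case ht2: (etype eps lam i.+2); rewrite ho1 ht2 /=.
  (* If [i.+2] exceeds [n], its gaps are past the end and both sides are false. *)
  case: (leqP i.+2 n) => hi2; first by rewrite -IH //= ?addn0.
  rewrite twoStepE //= gap_default; last by lia.
  rewrite !andbF /=; have -> : n.+1 - i.+2 = 0 by lia.
  by [].
by rewrite addn0 /twoStep -/(etype _ _ _) ht2 !andbF.
Qed.

(** A boundary gap of a chain is positive, so it is harmless exactly when odd; on the left, for
    [i > 1], this means that the preceding part has the other type. *)
Lemma good_chainE (eps : int) lam i n k :
  (eps = 1%R \/ eps = (-1)%R) -> nonincreasing_parts lam ->
  size lam <= n -> 0 < i <= n ->
  good_chain eps lam i k =
  [&& etype eps lam i, (i == 1) || ~~ etype eps lam i.-1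
    & chain_body (gaps lam i (n.+1 - i)) k].
Proof.
move=> heps hl hn /andP[hi hin].
rewrite /good_chain negb_or.
case ht: (etype eps lam i); last first.
  by rewrite /= addn0 /twoStep -/(etype _ _ _) ht !andbF.
case hne: (part lam i.-1 != part lam i); last first.
  rewrite /= addn0 twoStepE // hne !andbF /=; symmetry.
  case: i hi hin ht hne => // -[|i] _ hin ht /negbFE/eqP hne /=.
    (* Here [i = 1]: since [part lam 0 = 0], equality makes every part zero. *)
    have h0 j : nth 0 lam j = 0.
      by elim: j => [|j IHj]; [exact: esym hne | move: (hl j); lia].
    have hz j : gap lam j = 0 by rewrite /gap /part; case: j => [|j]; rewrite !h0.
    case: n hn hin => // -[|n] hn hin; first by rewrite subSS subn0 /=.
    by rewrite subSS subn0 /= !hz /=; case: k.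
  (* For [i > 1], equal neighbours have equal types, so the right side fails too. *)
  move: ht; rewrite !etypeE //= in hne *.
  by rewrite -hne => ->.
rewrite -(chain_bodyE k heps hl hn) ?hi ?hin //.
set P := all _ _; case ha: P => /=; last by rewrite andbF.
have -> : posEven (part lam (i + k.*2).+1 - part lam (i + k.*2).+2)
  = ~~ odd (gap lam (i + k.*2).+1).
  rewrite /posEven -/(gap _ _); case: posnP => //= h0.
  have := allP ha k; rewrite (mem_iota 0 k.+1) ltnSn => /(_ isT).
  by rewrite twoStepE ?addn_gt0 ?hi // h0 !andbF.
rewrite negbK; congr (_ && _).
case: i hi hin ht hne {P ha} => // -[|i] // _ hin ht hne /=.
rewrite /posEven -/(gap lam i.+1) (odd_gap heps hl) // ht.
have -> : 0 < gap lam i.+1 by move: hne (hl i); rewrite /gap /=; lia.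
by case: etype.
Qed.

(** * The function z as a sum over good chains *)

Lemma count_iota1 (P : pred nat) n :
  count P (iota 1 n) = \sum_(0 <= j < n) P j.+1.
Proof.
elim: n => [|n IH]; first by rewrite big_geq.
by rewrite big_nat_recr // -IH -[n.+1]addn1 iotaD count_cat /= addn0 addn1.
Qed.

(** Boundary gaps of a 2-step are positive, so even and positive even mean the same for them. *)
Lemma twoStep_bad_or_good eps lam i : nonincreasing_parts lam -> 0 < i ->
  (twoStep eps lam i : nat) = badStep eps lam i + good_chain eps lam i 0.
Proof.
move=> hl hi; rewrite /badStep /good_chain /= !addn0 andbT.
case h2: (twoStep _ _ _) => //=; move: h2; rewrite twoStepE //.
case/and4P=> _ _ hne hg; rewrite /posEven -!/(gap lam _) hg /=.
case: i hi hne {hg} => // -[|i] _ hne /=; first by case: odd.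
have -> /= : 0 < part lam i.+1 - part lam i.+2.
  by move: hne (hl i); rewrite /=; lia.
by case: odd; case: odd.
Qed.

Lemma sum_good_chain (eps : int) lam i n :
  (eps = 1%R \/ eps = (-1)%R) -> nonincreasing_parts lam ->
  size lam <= n -> 0 < i <= n ->
  \sum_(0 <= k < n) good_chain eps lam i k =
  [&& etype eps lam i, (i == 1) || ~~ etype eps lam i.-1
    & alive (gaps lam i (n.+1 - i))].
Proof.
move=> heps hl hn hi.
under eq_bigr => k _ do rewrite (good_chainE k heps hl hn hi).
case: etype => /=; last by rewrite big1_seq.
case: (_ || _) => /=; last by rewrite big1_seq.
by apply: sum_chain_body; rewrite size_gaps; lia.
Qed.

(** The good 2-steps are the chains with [k = 0], and a good 2-cluster with [k] members is a good
    chain of index [k.-1]. *)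
Lemma zfun_sum_good_chain eps lam : nonincreasing_parts lam ->
  zfun eps lam = \sum_(0 <= j < size lam) (gap lam (1 + j))./2 +
    \sum_(0 <= j < size lam) \sum_(0 <= k < size lam)
       good_chain eps lam j.+1 k.
Proof.
move=> hl; set n := size lam.
have hs : sfun lam = \sum_(0 <= j < n) (gap lam (1 + j))./2.
  by rewrite /sfun big_add1.
have htwo : count (twoStep eps lam) (iota 1 n) =
    count (badStep eps lam) (iota 1 n) +
    \sum_(0 <= j < n) good_chain eps lam j.+1 0.
  rewrite !count_iota1 -big_split /=; apply: eq_bigr => j _.
  exact: twoStep_bad_or_good.
rewrite /zfun hs htwo addnCA addKn -addnA; congr (_ + _).
have hin i : \sum_(2 <= k < n.+1) goodCluster eps lam i k =
             \sum_(1 <= k < n) good_chain eps lam i k.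
  by rewrite big_add1 /=; apply: eq_big_nat => -[].
have -> : nGoodClusters eps lam =
    \sum_(0 <= j < n) \sum_(1 <= k < n) good_chain eps lam j.+1 k.
  (* No 2-step starts at [n], so the range of [i1] may be extended by that index. *)
  have shift (f : nat -> nat) : f n = 0 ->
      \sum_(1 <= i < n) f i = \sum_(0 <= j < n) f j.+1.
    case: (n) => [|m] hf; first by rewrite !big_geq.
    by rewrite big_add1 big_nat_recr //= hf addn0.
  rewrite /nGoodClusters -/n; under eq_bigr do rewrite hin.
  apply: shift; rewrite big1_seq // => k _.
  by rewrite /good_chain /= addn0 {1}/twoStep ltnn /= andbF.
rewrite -big_split /=; case En: n => [|m]; first by rewrite !big_geq.
by apply: eq_bigr => j _; rewrite [RHS]big_ltn.
Qed.

Lemma zfun_zrun_size (eps : int) lam :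
  (eps = 1%R \/ eps = (-1)%R) -> nonincreasing_parts lam ->
  zfun eps lam = zrun (start eps lam) (gaps lam 1 (size lam)).
Proof.
move=> heps hl; rewrite zfun_sum_good_chain //.
rewrite (zrun_gapsE _ heps) ?is_off_start // -addnA; congr (_ + _).
rewrite (eq_big_nat _ _ (F2 := fun j => [&& etype eps lam j.+1,
  (j.+1 == 1) || ~~ etype eps lam j
    & alive (gaps lam j.+1 (size lam - j))] : nat)); last first.
  by move=> j hj; rewrite (sum_good_chain heps hl) ?subSS.
case En: (size lam) => [|m]; first by rewrite !big_geq //; case: start.
(* The term [i = 1] on the left is the chain pending in the start state; the last term on the right
   has an empty window. *)
rewrite big_nat_recl // [X in _ = _ + X]big_nat_recr //= subSnn /= !andbF addn0.
congr (_ + _).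
  by rewrite /start /=; case: etype; rewrite ?andbF //= subn0.
apply: eq_bigr => j _; rewrite -subnS subSS add1n.
by case: etype => /=; case: etype => //=; rewrite ?andbF.
Qed.

(** Trailing zero gaps add nothing. Partitions before and after a step can thus be read over the
    same number of gaps. *)
Lemma zfun_zrun (eps : int) lam n :
  (eps = 1%R \/ eps = (-1)%R) -> nonincreasing_parts lam -> size lam <= n ->
  zfun eps lam = zrun (start eps lam) (gaps lam 1 n).
Proof.
move=> heps hl hn; rewrite zfun_zrun_size // -(subnKC hn).
rewrite /gaps iotaD map_cat zrun_cat.
suff -> : [seq gap lam i | i <- iota (1 + size lam) (n - size lam)] =
          nseq (n - size lam) 0 by rewrite zrun_nseq0 addn0.
apply: (@eq_from_nth _ 0); rewrite size_gaps ?size_nseq // => j hj.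
by rewrite nth_gaps // nth_nseq if_same gap_default //; lia.
Qed.

(** * Parts and gaps after a step of the algorithm *)

(** Zeros of a nonincreasing sequence stand at its end, so dropping them moves no other entry. *)
Lemma nth_filter_neq0 (u : seq nat) j : nonincreasing_parts u ->
  nth 0 [seq x <- u | x != 0] j = nth 0 u j.
Proof.
elim: u j => [|x u IH] j hu //=.
have hu' : nonincreasing_parts u by move=> i; exact: (hu i.+1).
case: eqP => [x0|_] /=; last by case: j => //= j; exact: IH.
have h0 i : nth 0 (x :: u) i = 0.
  by elim: i => [|i IHi] //; move: (hu i); lia.
by rewrite IH // h0; exact: (h0 j.+1).
Qed.

Lemma ksStep_case1 lam i : nonincreasing_parts lam -> case1 lam i ->
  nonincreasing_parts (ksStep lam i) /\
  forall j, part (ksStep lam i) j.+1 = part lam j.+1 - (j < i).*2.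
Proof.
move=> hl h1; rewrite /ksStep h1; case/andP: (h1) => /andP[hi1 his] hd.
set u := _ ++ _.
have hu k : nth 0 u k = nth 0 lam k - (k < i).*2.
  rewrite nth_cat size_map size_takel //; case: ltnP => hk.
    by rewrite (nth_map 0) ?size_takel // nth_take.
  by rewrite nth_drop subnKC // subn0.
suff hdec : nonincreasing_parts u.
  by split=> k; rewrite /= ?nth_filter_neq0.
move=> k; rewrite !hu; have hk := hl k.
case: (ltngtP k.+1 i) => hki; try lia.
by move: hd; rewrite -hki /=; lia.
Qed.

Lemma case2_not_case1 eps lam i : case2 eps lam i -> case1 lam i = false.
Proof. by case/andP=> _ /eqP h; rewrite /case1 h; lia. Qed.

(** The order survives because the gaps on both sides of the pair are positive. *)
Lemma ksStep_case2 eps lam i : nonincreasing_parts lam -> case2 eps lam i ->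
  nonincreasing_parts (ksStep lam i) /\
  forall j, part (ksStep lam i) j.+1 = part lam j.+1 - (j.+1 < i) - (j <= i).
Proof.
move=> hl h2; rewrite /ksStep (case2_not_case1 h2).
case/andP: h2 => h2 /eqP heq; have hi1 : 0 < i by case/andP: h2.
have his : i < size lam by case/and3P: h2.
move: h2; rewrite twoStepE // => /and4P[_ _ hne hg].
set u := _ ++ _.
have hu k : nth 0 u k = nth 0 lam k - (k.+1 < i) - (k <= i).
  rewrite !nth_cat !size_map size_takel; last lia.
  rewrite size_takel; last by rewrite size_drop; lia.
  case: ltnP => hk.
    rewrite (nth_map 0) ?size_takel ?nth_take //; lia.
  case: ltnP => hk2; last first.
    by rewrite nth_drop (_ : i.+1 + (k - i.-1 - 2) = k); lia.
  rewrite (nth_map 0) ?nth_take ?size_takel ?size_drop //; try lia.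
  rewrite nth_drop; have -> : i.-1 + (k - i.-1) = k by lia.
  lia.
suff hdec : nonincreasing_parts u.
  by split=> k; rewrite /= ?nth_filter_neq0.
move=> k; rewrite !hu; have hk := hl k.
have hk1 : k.+2 = i -> nth 0 lam k.+1 < nth 0 lam k.
  by move=> e; move: hne hk; rewrite -e /=; lia.
have hk2 : k = i -> nth 0 lam k.+1 < nth 0 lam k.
  by move=> e; move: hg; rewrite -e /gap /=; lia.
lia.
Qed.

Lemma size_ksStep eps lam i : case1 lam i || case2 eps lam i ->
  size (ksStep lam i) <= size lam.
Proof.
rewrite /ksStep; case h1: (case1 lam i) => /= h.
  rewrite size_filter (leq_trans (count_size _ _)) // size_cat size_map.
  by rewrite -size_cat cat_take_drop.
have /and3P[hi1 his _] : twoStep eps lam i by case/andP: h.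
rewrite size_filter (leq_trans (count_size _ _)) // !size_cat !size_map.
by rewrite !size_takel ?size_drop; lia.
Qed.

Lemma leq_part lam i j : nonincreasing_parts lam -> 0 < i <= j ->
  part lam j <= part lam i.
Proof.
move=> hl /andP[hi hij]; rewrite -(subnKC hij).
elim: (j - i) => [|k IH]; first by rewrite addn0.
by apply: leq_trans IH; rewrite addnS; case: i hi {hij} => // i _; apply: hl.
Qed.

Lemma gap_ksStep_case1 lam i j : nonincreasing_parts lam -> case1 lam i ->
  0 < j -> gap (ksStep lam i) j = gap lam j - (j == i).*2.
Proof.
move=> hl h1; have [_ hp] := ksStep_case1 hl h1.
case: j => // j _; rewrite /gap !hp.
case/andP: h1 => /andP[hi _] hd.
case: (ltngtP j.+1 i) => hji; try lia.
have := @leq_part lam j.+2 i hl; rewrite hji /= => /(_ isT); lia.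
Qed.

Lemma gap_ksStep_case2 eps lam i j : nonincreasing_parts lam ->
  case2 eps lam i -> 0 < j ->
  gap (ksStep lam i) j = gap lam j - (j.+1 == i) - (j == i.+1).
Proof.
move=> hl h2; have [_ hp] := ksStep_case2 hl h2.
case: j => // j _; rewrite /gap !hp.
case/andP: h2 => h2 /eqP heq; have hi : 0 < i by case/andP: h2.
move: h2; rewrite twoStepE // => /and4P[_ _ hne hg].
have hL : 0 < part lam i.+1 by move: hg; rewrite /gap; lia.
(* Parts before the pair are at least 2, so subtracting 2 never truncates. *)
have hlt : 1 < i -> 1 < part lam i.-1.
  by move=> h; have := @leq_part lam i.-1 i hl; lia.
case: (ltngtP j.+2 i) => hji.
- have := @leq_part lam j.+2 i.-1 hl; lia.
- case: (ltngtP j i) => hji2; try lia.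
  have e : i = j.+1 by lia.
  rewrite e in heq hL *; lia.
- rewrite -hji in heq hL hlt hne *; rewrite /= in heq hL hne hlt *; lia.
Qed.

Lemma size_leq_gap lam i : 0 < gap lam i -> i <= size lam.
Proof. by move=> h; rewrite leqNgt; apply/negP=> /gap_default; lia. Qed.

Lemma gaps_split lam m n : gaps lam 1 (m + n) = gaps lam 1 m ++ gaps lam m.+1 n.
Proof. by rewrite /gaps iotaD map_cat. Qed.

Lemma gapsS lam m n : gaps lam m n.+1 = gap lam m :: gaps lam m.+1 n.
Proof. by []. Qed.

Lemma eq_gaps lam lam' m n : (forall j, m <= j < m + n -> gap lam j = gap lam' j) ->
  gaps lam m n = gaps lam' m n.
Proof. by move=> h; apply/eq_in_map => j; rewrite mem_iota; exact: h. Qed.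

(** * The drop of z along a step *)

Section Drop.

Variable eps : int.
Hypothesis heps : eps = 1%R \/ eps = (-1)%R.
Variable lam : seq nat.
Hypothesis hl : nonincreasing_parts lam.

Let state_at k := foldl next (start eps lam) (gaps lam 1 k).

Lemma etype_ksStep_case1 i : case1 lam i ->
  etype eps (ksStep lam i) 1 = etype eps lam 1.
Proof.
move=> h1; have [_ hp] := ksStep_case1 hl h1.
rewrite !(etypeE heps) hp; case/andP: h1 => /andP[hi _] hd.
have := @leq_part lam 1 i hl; rewrite hi /= => /(_ isT) h; rewrite oddB ?hi //=.
  by rewrite addbF.
lia.
Qed.

(** The first part loses 2 if [i > 1], but only 1 if [i = 1], which flips its type. *)
Lemma etype_ksStep_case2 i : case2 eps lam i ->
  etype eps (ksStep lam i) 1 = (1 < i) && etype eps lam 1.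
Proof.
move=> h2; have [_ hp] := ksStep_case2 hl h2.
rewrite !(etypeE heps) hp; case/andP: h2 => h2 /eqP heq.
have hi : 0 < i by case/andP: h2.
move: h2; rewrite twoStepE // => /and4P[ht _ hne hg].
have hL : 0 < part lam i by move: hg; rewrite /gap heq; lia.
case: (ltngtP 1 i) hi => //= hi _.
  have h : 1 < part lam 1 by have := @leq_part lam 1 i.-1 hl; have := @leq_part lam i.-1 i hl; lia.
  by rewrite -subnDA oddB //= addbF.
rewrite -hi in ht hL; move: ht; rewrite (etypeE heps) subn0 oddB //=.
by case: odd; case: (_ == _).
Qed.

(** [A] is the contribution of the gaps before [i], which the step leaves alone, and [l] lists those
    after [i]. *)
Lemma zfun_case1 i : case1 lam i -> exists A l,
  zfun eps lam = A + zrun (state_at i.-1) (gap lam i :: l) /\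
  zfun eps (ksStep lam i) = A + zrun (state_at i.-1) (gap lam i - 2 :: l).
Proof.
move=> h1; have [hl' _] := ksStep_case1 hl h1.
have hs : size (ksStep lam i) <= size lam.
  by apply: (@size_ksStep eps); rewrite h1.
have hg j : 0 < j -> _ := @gap_ksStep_case1 lam i j hl h1.
rewrite (zfun_zrun_size heps hl) (zfun_zrun heps hl' hs).
have -> : start eps (ksStep lam i) = start eps lam.
  by rewrite /start etype_ksStep_case1.
case/andP: h1 => /andP[hi his] _.
have -> : size lam = i.-1 + (size lam - i).+1 by lia.
rewrite !gaps_split !gapsS !prednK // !zrun_cat (hg _ hi) eqxx.
have -> : gaps (ksStep lam i) 1 i.-1 = gaps lam 1 i.-1.
  by apply: eq_gaps => j hj; rewrite hg; lia.
have -> : gaps (ksStep lam i) i.+1 (size lam - i) = gaps lam i.+1 (size lam - i).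
  by apply: eq_gaps => j hj; rewrite hg; lia.
by exists (zrun (start eps lam) (gaps lam 1 i.-1)), (gaps lam i.+1 (size lam - i)).
Qed.

(** The index [k.+2] ensures that a gap precedes the pair and that the start state is kept. *)
Lemma zfun_case2 k : case2 eps lam k.+2 -> exists A l,
  zfun eps lam = A + zrun (state_at k) [:: gap lam k.+1, 0, gap lam k.+3 & l] /\
  zfun eps (ksStep lam k.+2) =
    A + zrun (state_at k) [:: (gap lam k.+1).-1, 0, (gap lam k.+3).-1 & l].
Proof.
move=> h2; have [hl' _] := ksStep_case2 hl h2.
have hs : size (ksStep lam k.+2) <= size lam.
  by apply: (@size_ksStep eps); rewrite h2 orbT.
have hg j : 0 < j -> _ := @gap_ksStep_case2 eps lam k.+2 j hl h2.
rewrite (zfun_zrun_size heps hl) (zfun_zrun heps hl' hs).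
have -> : start eps (ksStep lam k.+2) = start eps lam.
  by rewrite /start etype_ksStep_case2.
case/andP: h2 => h2 /eqP heq.
move: h2; rewrite twoStepE // => /and4P[_ _ _ /size_leq_gap hk].
have h0 : gap lam k.+2 = 0 by rewrite /gap heq subnn.
have -> : size lam = k + (size lam - k.+3).+3 by lia.
rewrite !gaps_split !gapsS !zrun_cat h0 !hg // h0 !eqxx.
set n := size lam - k.+3.
have -> : gaps (ksStep lam k.+2) 1 k = gaps lam 1 k.
  by apply: eq_gaps => j hj; rewrite hg; lia.
have -> : gaps (ksStep lam k.+2) k.+4 n = gaps lam k.+4 n.
  by apply: eq_gaps => j hj; rewrite hg; lia.
exists (zrun (start eps lam) (gaps lam 1 k)), (gaps lam k.+4 n).
have -> : (k.+1 == k.+3) = false by lia.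
have -> : (k.+4 == k.+2) = false by lia.
by rewrite !subn0 !subn1.
Qed.

Lemma zfun_case2_first : case2 eps lam 1 ->
  zfun eps lam = (zfun eps (ksStep lam 1)).+1.
Proof.
move=> h2; have [hl' _] := ksStep_case2 hl h2.
have hs : size (ksStep lam 1) <= size lam.
  by apply: (@size_ksStep eps); rewrite h2 orbT.
have hg j : 0 < j -> _ := @gap_ksStep_case2 eps lam 1 j hl h2.
rewrite (zfun_zrun_size heps hl) (zfun_zrun heps hl' hs).
rewrite /start etype_ksStep_case2 //=.
case/andP: h2 => h2 /eqP heq.
move: h2; rewrite twoStepE // => /and4P[-> _ _ hg2].
have hk := size_leq_gap hg2.
have h0 : gap lam 1 = 0 by rewrite /gap heq subnn.
have -> : size lam = (size lam - 2).+2 by lia.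
set n := size lam - 2.
have -> : gaps lam 1 n.+2 = [:: 0, (gap lam 2).-1.+1 & gaps lam 3 n].
  by rewrite prednK // !gapsS h0.
have -> : gaps (ksStep lam 1) 1 n.+2 = [:: 0, (gap lam 2).-1 & gaps lam 3 n].
  rewrite !gapsS !hg // h0 !eqxx /= !subn0 subn1.
  by rewrite (@eq_gaps (ksStep lam 1) lam) // => j hj; rewrite hg; lia.
exact: zrun_sub1_head.
Qed.

Lemma is_off_state_at k : is_off (state_at k) = ~~ etype eps lam k.+1.
Proof. by rewrite (is_off_foldl heps _ hl) ?is_off_start. Qed.

Lemma zfun_ksStep_lt i : case1 lam i || case2 eps lam i ->
  zfun eps (ksStep lam i) < zfun eps lam.
Proof.
case/orP=> h.
  have [A [l [-> ->]]] := zfun_case1 h; rewrite ltn_add2l.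
  have : 1 < gap lam i by case/andP: h => _; rewrite /gap; lia.
  by case: (gap lam i) => [|[|d]] // _; rewrite subn2; exact: zrun_sub2.
case: i h => [|[|k]] h; first by case/andP: h.
  by rewrite (zfun_case2_first h).
have [A [l [-> ->]]] := zfun_case2 h; rewrite ltn_add2l.
case/andP: h => h _; move: h; rewrite twoStepE // => /and4P[ht _ hne hg].
have hg1 : 0 < gap lam k.+1.
  by move: hne (hl k); rewrite /gap /=; lia.
rewrite -{2}(prednK hg1) -{2}(prednK hg); apply: zrun_sub1.
(* The state after gap [k.+1] describes part [k.+2], whose type is the one allowed in 2-steps. *)
rewrite prednK // is_off_next is_off_state_at (odd_gap heps hl) // ht.
by case: etype.
Qed.

Lemma gaps_catE n l1 l2 : gaps lam 1 n = l1 ++ l2 ->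
  l1 = gaps lam 1 (size l1) /\ l2 = gaps lam (size l1).+1 (size l2).
Proof.
move=> h; have := congr1 size h; rewrite size_gaps size_cat => hn.
move: h; rewrite hn gaps_split => /eqP.
by rewrite eqseq_cat ?size_gaps // => /andP[/eqP-> /eqP->].
Qed.

Lemma zfun_exact_step : 0 < zfun eps lam ->
  exists2 i, case1 lam i || case2 eps lam i &
             zfun eps lam = (zfun eps (ksStep lam i)).+1.
Proof.
rewrite {1}(zfun_zrun_size heps hl) => /zrun_exact_step[].
- move=> [l1 [d [l2 [/gaps_catE[e1 e2] hq]]]].
  set k := size l1 in e1 e2; case: e2 => hd _.
  have h1 : case1 lam k.+1.
    rewrite /case1 /= size_leq_gap -?hd //=.
    by move: hd; rewrite /gap /=; lia.
  exists k.+1; first by rewrite h1.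
  have [A [l [-> ->]]] := zfun_case1 h1.
  by rewrite -hd subn2 zrun_sub2_eq ?addnS // /state_at /= -e1.
- move=> [l1 [a [b [l2 [/gaps_catE[e1 e2] hq ha]]]]].
  set k := size l1 in e1 e2; case: e2 => hga hg0 hgb _.
  have hq1 : state_at k = Off by rewrite /state_at -e1.
  (* Part [k.+1] has the wrong type; the odd gap and then the zero gap give parts [k.+2] and [k.+3]
     the right one. *)
  have := is_off_state_at k; rewrite hq1 /= => /esym/negbTE ht1.
  have := @odd_gap eps heps lam k.+1 hl isT.
  rewrite -hga ht1 /= ha => /esym ht2.
  have := @odd_gap eps heps lam k.+2 hl isT.
  rewrite -hg0 ht2 /= => /esym/negbFE ht3.
  have h2 : case2 eps lam k.+2.
    rewrite /case2 twoStepE // ht2 ht3 -hgb /= andbT.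
    by move: hga hg0 (hl k.+1); rewrite /gap /=; lia.
  exists k.+2; first by rewrite h2 orbT.
  have [A [l [-> ->]]] := zfun_case2 h2.
  by rewrite hq1 -hga -hgb zrun_sub1_off ?addnS.
- move=> [hq [b [l2 e]]].
  have [_ /=] := @gaps_catE (size lam) [::] _ e; case=> hg1 hg2 _.
  have ht1 : etype eps lam 1 by move: hq; rewrite /start; case: etype.
  have := @odd_gap eps heps lam 1 hl isT.
  rewrite -hg1 ht1 /= => /esym/negbFE ht2.
  have h2 : case2 eps lam 1.
    rewrite /case2 twoStepE // ht1 ht2 -hg2 /= andbT.
    by move: hg1 hg2 (hl 0); rewrite /gap /=; lia.
  by exists 1; [rewrite h2 orbT | exact: zfun_case2_first].
(* The start state is never [Second]. *)
- by rewrite /start; case: etype => -[].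
Qed.

End Drop.

(** * Longest admissible sequences *)

Lemma nonincreasing_ksStep eps lam i : nonincreasing_parts lam ->
  case1 lam i || case2 eps lam i -> nonincreasing_parts (ksStep lam i).
Proof.
by move=> hl /orP[/(ksStep_case1 hl)|/(ksStep_case2 hl)] [].
Qed.

Theorem mainTheorem10 (eps : int) (N : nat) (lam : seq nat) :
  (eps = 1%R \/ eps = (-1)%R) -> inP eps N lam ->
  (exists s : seq nat, admissible eps lam s /\ size s = zfun eps lam) /\
  (forall s : seq nat, admissible eps lam s -> size s <= zfun eps lam).
Proof.
move=> heps /and4P[/sorted_nonincreasing_parts hl _ _ _] {N}; split.
  (* Exact steps are taken until z reaches 0. *)
  move e: (zfun eps lam) => z; elim: z lam hl e => [|z IH] lam hl e.
    by exists [::].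
  have [|i hi] := zfun_exact_step heps hl; first by rewrite e.
  rewrite e => -[/esym ei].
  have [s [hs <-]] := IH _ (nonincreasing_ksStep hl hi) ei.
  by exists (i :: s); rewrite /= hi.
move=> s; elim: s lam hl => [|i s IH] lam hl //= /andP[hi hs].
apply: leq_ltn_trans (zfun_ksStep_lt heps hl hi).
exact: IH (nonincreasing_ksStep hl hi) hs.
Qed.
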